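(* Let $A$ be a unital semisimple (complex) Banach algebra with essential socle and let $a\in A$. The following conditions are equivalent: (1) $a$ is invertible in $A$. (2) $a\in A^\wedge$ and for every $u\in F_1(A)$ there exist $x\in L_u\setminus\{0\}$ and $y\in R_u\setminus\{0\}$ such that $x\leq^- a$ and $y\leq^- a$.
   Context: An element $a$ of a unital ring $A$ is regular if there is $x\in A$ with $axa=a$; $A^\wedge$ is the set of regular elements and $A^\bullet$ the set of idempotents. Write $\mathrm{ann}_l(a)=\{x\in A: xa=0\}$ and $\mathrm{ann}_r(a)=\{x\in A: ax=0\}$. For $a,b\in A$, $a\leq^- b$ means that there exist $p,q\in A^\bullet$ with $\mathrm{ann}_l(a)=\mathrm{ann}_l(p)$, $\mathrm{ann}_r(a)=\mathrm{ann}_r(q)$, $pa=pb$ and $aq=bq$. Let $A$ be a unital semisimple complex Banach algebra. A minimal idempotent is an element $e$ with $e^2=e\neq0$ and $eAe=\mathbb{C}e$. $F_1(A)$ is the set of rank-one elements: nonzero $u\in A$ that belong to some minimal left ideal of $A$, i.e. $u=ue$ for some minimal idempotent $e$. For $u\in F_1(A)$, $L_u=\{ux: x\in A\}$ and $R_u=\{xu: x\in A\}$. The socle $\mathrm{Soc}(A)$ is the sum of all minimal left ideals of $A$ (equivalently of all minimal right ideals), and is $\{0\}$ if there are none. A non-zero ideal $I$ is essential if it has non-zero intersection with every non-zero ideal of $A$; for semisimple $A$ this is equivalent to: $aI=0$ with $a\in A$ implies $a=0$. *)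

(* Defs.v *)
From HB Require Import structures.
From mathcomp Require Import all_boot all_order all_algebra.
From mathcomp Require Import all_classical all_reals all_analysis.
From mathcomp Require Export complex.
Set Implicit Arguments.
Unset Strict Implicit.
Unset Printing Implicit Defensive.
Import Order.TTheory GRing.Theory Num.Theory.
Import numFieldNormedType.Exports.
Local Open Scope classical_set_scope.
Local Open Scope ring_scope.

(* The hierarchy has no join of (semi-)normed modules and rings other than   *)
(* numDomainType, so the product is a field of the mixin, and the algebra    *)
(* structure lives on the convertible alias [algebra_of A] below.            *)
(* [`|1| = 1] is not required: it can always be obtained by renorming.       *)
HB.mixin Record CompleteNormedModule_isBanachAlgebra (K : numFieldType) A
    of CompleteNormedModule K A := {
  bmul : A -> A -> A;
  bone : A;
  bmulA : associative bmul;
  bmul1 : left_id bone bmul;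
  bmulr1 : right_id bone bmul;
  bmulDl : left_distributive bmul +%R;
  bmulDr : right_distributive bmul +%R;
  bone_neq0 : bone != 0;
  bscaleAl : forall (k : K) (x y : A), k *: bmul x y = bmul (k *: x) y;
  bscaleAr : forall (k : K) (x y : A), k *: bmul x y = bmul x (k *: y);
  ler_norm_bmul : forall x y : A, `|bmul x y| <= `|x| * `|y|
}.

#[short(type="banachAlgType")]
HB.structure Definition BanachAlgebra (K : numFieldType) :=
  {A of CompleteNormedModule K A
      & CompleteNormedModule_isBanachAlgebra K A}.

Definition algebra_of (K : numFieldType) (A : banachAlgType K) : Type := A.

Section AlgebraOf.
Variables (K : numFieldType) (A : banachAlgType K).

HB.instance Definition _ := GRing.Lmodule.copy (algebra_of A) A.

HB.instance Definition _ := GRing.Zmodule_isNzRing.Build (algebra_of A)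
  (@bmulA K A) (@bmul1 K A) (@bmulr1 K A) (@bmulDl K A) (@bmulDr K A)
  (@bone_neq0 K A).

HB.instance Definition _ :=
  GRing.Lmodule_isLalgebra.Build K (algebra_of A) (@bscaleAl K A).

HB.instance Definition _ :=
  GRing.Lalgebra_isAlgebra.Build K (algebra_of A) (@bscaleAr K A).

End AlgebraOf.

Section RingNotions.
Variable A : nzRingType.
Implicit Types (a b p q u x y : A) (I J L M : set A).

Definition invertible a : Prop := exists b, a * b = 1 /\ b * a = 1.

Definition regular_elements : set A := [set a | exists x, a * x * a = a].

Definition idempotents : set A := [set p | p * p = p].

Definition ann_l a : set A := [set x | x * a = 0].
Definition ann_r a : set A := [set x | a * x = 0].

Definition minus_le a b : Prop :=
  exists p q, [/\ idempotents p /\ idempotents q,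
    ann_l a = ann_l p, ann_r a = ann_r q, p * a = p * b & a * q = b * q].

(* Over a unital algebra, closure under scalars is automatic for one-sided   *)
(* and two-sided ideals, since k *: x = k%:A * x = x * k%:A.                 *)
Definition left_ideal I : Prop :=
  [/\ I 0, forall x y, I x -> I y -> I (x + y) & forall a x, I x -> I (a * x)].

Definition two_sided_ideal I : Prop :=
  left_ideal I /\ forall a x, I x -> I (x * a).

Definition maximal_left_ideal M : Prop :=
  [/\ left_ideal M, M <> setT &
    forall J, left_ideal J -> M `<=` J -> J = M \/ J = setT].

Definition jacobson_radical : set A :=
  \bigcap_(M in maximal_left_ideal) M.

Definition semisimple : Prop := jacobson_radical = [set 0].

Definition minimal_left_ideal L : Prop :=
  [/\ left_ideal L, L <> [set 0] &
    forall J, left_ideal J -> J `<=` L -> J = [set 0] \/ J = L].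

Definition rank_one : set A :=
  [set u | u <> 0 /\ exists2 L, minimal_left_ideal L & L u].

(* The empty sequence puts 0 in the socle, so the socle is {0} when there    *)
(* are no minimal left ideals.                                               *)
Definition socle : set A :=
  [set x | exists2 s : seq A,
    (forall y, y \in s -> exists2 L, minimal_left_ideal L & L y) &
    x = \sum_(y <- s) y].

Definition essential I : Prop :=
  [/\ two_sided_ideal I, I <> [set 0] &
    forall J, two_sided_ideal J -> J <> [set 0] -> I `&` J <> [set 0]].

Definition Lset u : set A := [set u * x | x in [set: A]].
Definition Rset u : set A := [set x * u | x in [set: A]].

Lemma minimal_left_ideal_mulr L a : minimal_left_ideal L ->
  [set x * a | x in L] = [set 0] \/ minimal_left_ideal [set x * a | x in L].
Proof.
move=> [[L0 LD LM] Ln Lmin].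
have [->|nz] := pselect ([set x * a | x in L] = [set 0]); [by left|right].
split=> //.
  split; first by exists 0; rewrite ?mul0r.
    by move=> _ _ [x Lx <-] [y Ly <-]; exists (x + y); [exact: LD|rewrite mulrDl].
  by move=> b _ [x Lx <-]; exists (b * x); [exact: LM|rewrite mulrA].
move=> J [J0 JD JM] sub.
have [] := Lmin [set x | L x /\ J (x * a)].
- split; first by rewrite /= mul0r.
    by move=> x y [Lx Jx] [Ly Jy]; split; [exact: LD|rewrite mulrDl; exact: JD].
  by move=> b x [Lx Jx]; split; [exact: LM|rewrite -mulrA; exact: JM].
- by move=> x [].
- move=> E; left; apply/seteqP; split=> [y Jy|_ -> //].
  have [x Lx xy] := sub _ Jy; move: Jy; rewrite -xy => Jxa.
  have : [set x | L x /\ J (x * a)] x by [].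
  by rewrite E /= => ->; rewrite mul0r.
- move=> E; right; apply/seteqP; split=> [//|_ [x Lx <-]].
  by move: Lx; rewrite -{1}E => -[].
Qed.

Lemma socle_two_sided_ideal : two_sided_ideal socle.
Proof.
split; first split.
- by exists [::]; rewrite ?big_nil.
- move=> _ _ [s sP ->] [t tP ->]; exists (s ++ t); rewrite ?big_cat //.
  by move=> y; rewrite mem_cat => /orP[/sP|/tP].
- move=> a _ [s sP ->]; exists [seq a * y | y <- s]; last first.
    by rewrite big_map mulr_sumr.
  move=> z /mapP[y /sP[L mL Ly] ->]; exists L => //.
  by case: mL => -[_ _ LM] _ _; exact: LM.
- move=> a _ [s sP ->]; rewrite mulr_suml.
  exists [seq y * a | y <- s & y * a != 0]; last first.
    rewrite big_map big_filter [LHS](bigID (fun y => y * a != 0)) /=.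
    by rewrite [X in _ + X]big1 ?addr0 // => y; rewrite negbK => /eqP.
  move=> z /mapP[y]; rewrite mem_filter => /andP[ya /sP[L mL Ly]] ->.
  have Ey : [set x * a | x in L] (y * a) by exists y.
  exists [set x * a | x in L] => //.
  have [E|//] := minimal_left_ideal_mulr a mL.
  by move: Ey ya; rewrite E /= => ->; rewrite eqxx.
Qed.

End RingNotions.

Arguments socle A : clear implicits.

(* Main.v *)
(* Semisimplicity makes A semiprime, so that each rank-one u is regular, say
   u = u d u.  If a is invertible then p = u d and q = d u are nonzero
   idempotents of uA and Au, with p a <=^- a and a q <=^- a.
   Conversely let a = a b a.  If x <=^- a then x lies in aA and in Aa, so
   (1 - a b) x = 0 = x (1 - b a).  If the idempotent g = 1 - a b were nonzero, the
   essential socle would provide a rank-one element u in gA, and any x in uA with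
   x <=^- a would satisfy x = g x = 0; symmetrically for 1 - b a. *)
Require Import Defs.
From mathcomp Require Import all_boot all_order all_algebra.
From mathcomp Require Import all_classical all_reals all_analysis.
Import GRing.Theory.
Local Open Scope classical_set_scope.
Local Open Scope ring_scope.
Local Open Scope complex_scope.

Section Rings.
Set Implicit Arguments.
Unset Strict Implicit.
Variable A : nzRingType.
Implicit Types b f g u w : A.

(** A maximal left ideal [M] missing [w] would satisfy M + A w = A, so it would contain some 1 - b
    w. *)
Lemma square_zero_in_radical w :
  (forall b, (b * w) * (b * w) = 0) -> jacobson_radical w.
Proof.
move=> sq0 M [Mid MT Mmax]; have [M0 MD MM] := Mid.
(* [J] is the left ideal M + A w. *)
pose J := [set z | exists b, M (z - b * w)].
have Jid : left_ideal J.
  split.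
  - by exists 0; rewrite mul0r subr0.
  - move=> x y [b Mb] [c Mc]; exists (b + c).
    by rewrite mulrDl opprD addrACA; exact: MD.
  - by move=> c x [b Mb]; exists (c * b); rewrite -mulrA -mulrBr; exact: MM.
have MJ : M `<=` J by move=> x Mx; exists 0; rewrite mul0r subr0.
have Jw : J w by exists 1; rewrite mul1r subrr.
have [JM|JT] := Mmax J Jid MJ; first by rewrite -JM.
have [b Mb] : J 1 by rewrite JT.
(* [1 - b w] is a unit, since [(b w)^2 = 0]. *)
have M1 : M 1.
  have := MM (1 + b * w) _ Mb.
  by rewrite mulrBr mulr1 mulrDl mul1r sq0 addr0 addrK.
by case: MT; apply/seteqP; split=> // x _; rewrite -[x]mulr1; exact: MM.
Qed.

Hypothesis ss : semisimple A.

(** Each b w squares to b (w b w) = 0, so [w] lies in the radical. *)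
Lemma semisimple_semiprime w : (forall b, w * b * w = 0) -> w = 0.
Proof.
move=> w0; suff: jacobson_radical w by rewrite ss.
by apply: square_zero_in_radical => b; rewrite -mulrA (mulrA w) w0 mulr0.
Qed.

Lemma rank_one_regular u : rank_one u -> exists d, u * d * u = u.
Proof.
move=> [u0 [L [[L0 LD LM] _ Lmin] Lu]].
have [b ubu] : exists b, u * b * u <> 0.
  apply: contrapT => nb; apply/u0/semisimple_semiprime => b.
  by apply: contrapT => ubu; apply: nb; exists b.
have [c cubu] : exists c, c * (u * b * u) = u.
  (* The nonzero left ideal A u b u lies in [L], so by minimality it is [L] and contains [u]. *)
  pose J := [set c * (u * b * u) | c in [set: A]].
  have Jid : left_ideal J.
    split; first by exists 0; rewrite ?mul0r.
      by move=> _ _ [x _ <-] [y _ <-]; exists (x + y); rewrite ?mulrDl.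
    by move=> e _ [x _ <-]; exists (e * x); rewrite ?mulrA.
  have JL : J `<=` L by move=> _ [x _ <-]; rewrite mulrA; exact: LM.
  have [E|E] := Lmin J Jid JL.
    have : J (u * b * u) by exists 1; rewrite ?mul1r.
    by rewrite E.
  by move: Lu; rewrite -E => -[c _ cu]; exists c.
(* Kernel on [L] of right multiplication by b u; it omits [u], so minimality makes it zero. *)
pose K := [set y | L y /\ y * b * u = 0].
have Kid : left_ideal K.
  split; first by rewrite /K /= !mul0r.
    move=> x y [Lx x0] [Ly y0]; split; first exact: LD.
    by rewrite !mulrDl x0 y0 addr0.
  by move=> e x [Lx x0]; split; [exact: LM|rewrite -!mulrA (mulrA x) x0 mulr0].
have [E|E] := Lmin K Kid (fun _ => @proj1 _ _); last first.
  by move: Lu; rewrite -E => -[].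
(* Right multiplication by b u sends both u b c u and [u] to u b u, so their difference lies in
   [K]. *)
exists (b * c); apply/eqP; rewrite -subr_eq0; apply/eqP.
suff : K (u * (b * c) * u - u) by rewrite E.
split; first by apply: LD; [exact: LM|rewrite -mulN1r; exact: LM].
by rewrite !mulrBl -!mulrA (mulrA u b u) cubu mulrA subrr.
Qed.

(** Right multiplication carries [L] to L b, which is again minimal because it is nonzero. *)
Lemma rank_one_mulr u b : rank_one u -> u * b <> 0 -> rank_one (u * b).
Proof.
move=> [_ [L Lmin Lu]] ub0; split=> //.
have Lub : [set x * b | x in L] (u * b) by exists u.
exists [set x * b | x in L] => //.
by have [E|//] := minimal_left_ideal_mulr b Lmin; rewrite E in Lub.
Qed.

Lemma rank_one_mull u b : rank_one u -> b * u <> 0 -> rank_one (b * u).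
Proof.
move=> [_ [L Lmin Lu]] bu0; split=> //; exists L => //.
by case: Lmin => -[_ _ LM] _ _; exact: LM.
Qed.

Hypothesis soc : essential (socle A).

(** Otherwise [f] lies in the right annihilator [J] of the socle, so [J] meets the socle. A common
    element [w] has w b in the socle, hence w b w = 0 for all b, and semiprimeness gives w = 0. *)
Lemma exists_rank_one_mulr f : f <> 0 -> exists2 u, rank_one u & u * f <> 0.
Proof.
move=> f0; have [[_ SM] _ Sess] := soc; apply: contrapT => nu.
pose J := [set z | forall s, socle A s -> s * z = 0].
have Jid : two_sided_ideal J.
  split; first split.
  - by move=> s _; rewrite mulr0.
  - by move=> x y Jx Jy s Ss; rewrite mulrDr Jx // Jy // addr0.
  - by move=> b x Jx s Ss; rewrite mulrA Jx //; exact: SM.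
  - by move=> b x Jx s Ss; rewrite mulrA Jx // mul0r.
have Jf : J f.
  move=> _ [s sP ->]; rewrite mulr_suml big_seq big1 // => y /sP[L Lmin Ly].
  apply: contrapT => yf; apply: nu; exists y => //; split; last by exists L.
  by move=> y0; rewrite y0 mul0r in yf.
apply: (Sess J Jid) => [J0|]; first by rewrite J0 in Jf.
apply/seteqP; split=> [w [Sw Jw]|_ ->]; last first.
  by case: Jid => -[J0 _ _] _; split=> //; exists [::]; rewrite ?big_nil.
by apply: semisimple_semiprime => b; apply: Jw; exact: SM.
Qed.

(** Mirror argument with the left annihilator of the socle, using that b w stays in the socle. *)
Lemma exists_rank_one_mull g : g <> 0 -> exists2 u, rank_one u & g * u <> 0.
Proof.
move=> g0; have [[[_ _ MS] _] _ Sess] := soc; apply: contrapT => nu.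
pose J := [set z | forall s, socle A s -> z * s = 0].
have Jid : two_sided_ideal J.
  split; first split.
  - by move=> s _; rewrite mul0r.
  - by move=> x y Jx Jy s Ss; rewrite mulrDl Jx // Jy // addr0.
  - by move=> b x Jx s Ss; rewrite -mulrA Jx // mulr0.
  - by move=> b x Jx s Ss; rewrite -mulrA Jx //; exact: MS.
have Jg : J g.
  move=> _ [s sP ->]; rewrite mulr_sumr big_seq big1 // => y /sP[L Lmin Ly].
  apply: contrapT => gy; apply: nu; exists y => //; split; last by exists L.
  by move=> y0; rewrite y0 mulr0 in gy.
apply: (Sess J Jid) => [J0|]; first by rewrite J0 in Jg.
apply/seteqP; split=> [w [Sw Jw]|_ ->]; last first.
  by case: Jid => -[J0 _ _] _; split=> //; exists [::]; rewrite ?big_nil.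
by apply: semisimple_semiprime => b; rewrite -mulrA; apply: Jw; exact: MS.
Qed.

End Rings.

Section MinusOrder.
Set Implicit Arguments.
Unset Strict Implicit.
Variable A : nzRingType.
Implicit Types a b p q x : A.

(** Since 1 - p kills [p] from the left, it kills [x] too, so x = p x = p a; likewise x = x q = a
    q. *)
Lemma minus_le_factor x a :
  minus_le x a -> exists p q, x = p * a /\ x = a * q.
Proof.
move=> [p [q [[pp qq] xp xq pxa axq]]]; exists p, q; split.
  have : ann_l x (1 - p) by rewrite xp /ann_l /= mulrBl mul1r pp subrr.
  by rewrite /ann_l /= mulrBl mul1r => /eqP; rewrite subr_eq0 -pxa => /eqP.
have : ann_r x (1 - q) by rewrite xq /ann_r /= mulrBr mulr1 qq subrr.
by rewrite /ann_r /= mulrBr mulr1 => /eqP; rewrite subr_eq0 -axq => /eqP.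
Qed.

Lemma minus_le_idempotent_mull p a b :
  p * p = p -> a * b = 1 -> b * a = 1 -> minus_le (p * a) a.
Proof.
(* As [b] is the inverse of [a], the second idempotent is the conjugate of [p] by [a]. *)
move=> pp ab ba; exists p, (b * p * a).
have abp : a * (b * p * a) = p * a by rewrite !mulrA ab mul1r.
split.
- by split=> //; rewrite /idempotents /= -mulrA abp mulrA -(mulrA b) pp.
- apply/seteqP; split=> y; rewrite /ann_l /= => y0.
    by rewrite -[p]mulr1 -ab (mulrA p) mulrA y0 mul0r.
  by rewrite mulrA y0 mul0r.
- apply/seteqP; split=> y; rewrite /ann_r /= => y0.
    by rewrite -!mulrA (mulrA p) y0 mulr0.
  by rewrite -abp -mulrA y0 mulr0.
- by rewrite mulrA pp.
- by rewrite -mulrA abp mulrA pp.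
Qed.

Lemma minus_le_idempotent_mulr q a b :
  q * q = q -> a * b = 1 -> b * a = 1 -> minus_le (a * q) a.
Proof.
move=> qq ab ba.
(* Conjugating [q] moves it to the left of [a], which reduces to the previous lemma. *)
have pp : (a * q * b) * (a * q * b) = a * q * b.
  by rewrite -!mulrA (mulrA b) ba mul1r (mulrA q q) qq.
have -> : a * q = (a * q * b) * a by rewrite -mulrA ba mulr1.
exact: minus_le_idempotent_mull pp ab ba.
Qed.

End MinusOrder.

Lemma invertible_iff_minus_le_rank_one (A : nzRingType) (ss : semisimple A)
    (soc : essential (socle A)) (a : A) :
  invertible a <->
  (regular_elements a /\
   forall u : A, rank_one u ->
     exists x y : A,
       [/\ (Lset u `\ 0) x, (Rset u `\ 0) y, minus_le x a & minus_le y a]).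
Proof.
split=> [[b [ab ba]]|[[b aba] H]].
  split; first by exists b; rewrite ab mul1r.
  move=> u u1; have [u0 _] := u1; have [d udu] := rank_one_regular ss u1.
  exists (u * d * a), (a * (d * u)); split.
  - split; first by exists (d * a); rewrite ?mulrA.
    (* If u d a = 0, cancelling [a] gives u d = 0, hence u = u d u = 0. *)
    by move=> /= E; apply: u0; rewrite -udu -[u * d]mulr1 -ab !mulrA E !mul0r.
  - split; first by exists (a * d); rewrite ?mulrA.
    move=> /= E; apply: u0.
    by rewrite -udu -mulrA -[d * u]mul1r -ba -[b * a * _]mulrA E !mulr0.
  - by apply: minus_le_idempotent_mull ab ba; rewrite mulrA udu.
  - by apply: minus_le_idempotent_mulr ab ba; rewrite -mulrA (mulrA u) udu.
exists b; split; apply/eqP; rewrite eq_sym -subr_eq0; apply/eqP.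
- set g := 1 - a * b.
  have ga : g * a = 0 by rewrite mulrBl mul1r aba subrr.
  have gg : g * g = g by rewrite {2}/g mulrBr mulr1 mulrA ga mul0r subr0.
  apply: contrapT => /(exists_rank_one_mull ss soc)[u u1 gu0].
  (* Right multiples of g u are fixed by [g], whereas [g] kills everything in a A. *)
  have [x [_ [[[z _ zx] x0] _ xa _]]] := H _ (rank_one_mull u1 gu0).
  have [_ [q [_ xaq]]] := minus_le_factor xa.
  have gx : g * x = x by rewrite -zx !mulrA gg.
  by apply: x0; rewrite /= -gx xaq mulrA ga mul0r.
- set f := 1 - b * a.
  have af : a * f = 0 by rewrite mulrBr mulr1 mulrA aba subrr.
  have ff : f * f = f by rewrite {1}/f mulrBl mul1r -mulrA af mulr0 subr0.
  apply: contrapT => /(exists_rank_one_mulr ss soc)[u u1 uf0].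
  (* Here [y] is a left multiple of u f, so y f = y, while y in A a forces y f = 0. *)
  have [_ [y [_ [[z _ zy] y0] _ ya]]] := H _ (rank_one_mulr u1 uf0).
  have [p [_ [ypa _]]] := minus_le_factor ya.
  have yf : y * f = y by rewrite -zy -!mulrA ff.
  by apply: y0; rewrite /= -yf ypa -mulrA af mulr0.
Qed.

Theorem proposition2p19 (R : realType) (A : banachAlgType R[i])
    (hss : semisimple (algebra_of A))
    (hsoc : essential (socle (algebra_of A)))
    (a : algebra_of A) :
  invertible a <->
  (regular_elements a /\
   forall u : algebra_of A, rank_one u ->
     exists x y : algebra_of A,
       [/\ (Lset u `\ 0) x, (Rset u `\ 0) y, minus_le x a & minus_le y a]).
Proof. exact: invertible_iff_minus_le_rank_one hss hsoc a. Qed.
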